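(* $\hat{\mathcal S}_\alpha(x_1, \ldots , x_n) = \mathcal S_\beta(x_1, \ldots , x_n)$ if and only if $\alpha=\beta$ and either $\alpha$ has all parts the same, or all parts of $\alpha$ are $1$ or $2$, or $n=\ell(\alpha)$ and consecutive parts of $\alpha$ differ by at most $1$.
   Context: $\alpha,\beta$ are compositions with at most $n$ parts. $\mathcal S_\alpha(x_1,\ldots,x_n)$ is the quasisymmetric Schur polynomial of Haglund–Luoto–Mason–van Willigenburg: the generating function of fillings of the composition diagram of $\alpha$ (French notation, row $i$ has $\alpha_i$ left-justified boxes) with entries in $\{1,\ldots,n\}$ such that rows weakly decrease left to right, the first column strictly increases bottom to top, and every triple is an inversion triple. Here a type A triple is boxes $z,x$ adjacent in a row ($z$ left) and $y$ above $x$ in a higher row, with the lower row weakly longer; a type B triple is $z,x$ adjacent in a row and $y$ below $z$ in a lower row, with the higher row strictly longer; a triple is an inversion triple unless $z\ge y\ge x$. The Young quasisymmetric Schur polynomial is $\hat{\mathcal S}_\alpha(x_1,\ldots,x_n)=\mathcal S_{\mathrm{rev}(\alpha)}(x_n,\ldots,x_1)$, where $\mathrm{rev}(\alpha)$ is $\alpha$ reversed. *)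

(* Defs.v *)
From mathcomp Require Import all_boot all_order all_algebra.
From mathcomp Require Import mpoly.

Set Implicit Arguments.
Unset Strict Implicit.
Unset Printing Implicit Defensive.

Import GRing.Theory.

(* A composition is a finite (possibly empty) sequence of positive integers. *)
Definition is_composition (a : seq nat) : bool := all (fun p => 0 < p) a.

Section Diagram.
Variable a : seq nat.

(* Rows and columns are numbered from 0; row 0 is the bottom row (French
   notation), so a larger row index means a higher row. *)
Definition box : Type := {i : 'I_(size a) & 'I_(nth 0 a i)}.

Definition row_of (b : box) : nat := tag b.
Definition col_of (b : box) : nat := tagged b.
Definition row_len (b : box) : nat := nth 0 a (row_of b).

Definition adjacent (z x : box) : bool :=
  (row_of z == row_of x) && (col_of x == (col_of z).+1).

Definition typeA_triple (z x y : box) : bool :=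
  [&& adjacent z x, col_of y == col_of x, row_of x < row_of y
    & row_len y <= row_len x].

Definition typeB_triple (z x y : box) : bool :=
  [&& adjacent z x, col_of y == col_of z, row_of y < row_of z
    & row_len y < row_len z].

(* Entries are shifted down by one: k : 'I_n stands for k + 1 in {1, ..., n}. *)
Variable n : nat.

Definition inversion_triple (T : {ffun box -> 'I_n}) (z x y : box) : bool :=
  ~~ ((T y <= T z) && (T x <= T y)).

Definition rows_weakly_decrease (T : {ffun box -> 'I_n}) : bool :=
  [forall b : box, forall c : box,
    (row_of b == row_of c) && (col_of b < col_of c) ==> (T c <= T b)].

Definition first_col_strictly_increases (T : {ffun box -> 'I_n}) : bool :=
  [forall b : box, forall c : box,
    [&& col_of b == 0, col_of c == 0 & row_of b < row_of c] ==> (T b < T c)].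

Definition triples_are_inversions (T : {ffun box -> 'I_n}) : bool :=
  [forall z : box, forall x : box, forall y : box,
    typeA_triple z x y || typeB_triple z x y ==> inversion_triple T z x y].

Definition composition_tableau (T : {ffun box -> 'I_n}) : bool :=
  [&& rows_weakly_decrease T, first_col_strictly_increases T
    & triples_are_inversions T].

End Diagram.

Local Open Scope ring_scope.

Definition quasisymmetric_schur (n : nat) (a : seq nat) : {mpoly int[n]} :=
  \sum_(T : {ffun box a -> 'I_n} | composition_tableau T)
    \prod_(b : box a) 'X_(T b).

(* The substitution x_i |-> x_(n+1-i) in the polynomial of the reversal. *)
Definition young_quasisymmetric_schur (n : nat) (a : seq nat) :
    {mpoly int[n]} :=
  quasisymmetric_schur n (rev a) \mPo [tuple 'X_(rev_ord i) | i < n].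

(* Main.v *)
Require Import Defs.
From mathcomp Require Import all_boot all_order all_algebra.
From mathcomp Require Import all_fingroup.
From mathcomp Require Import mpoly zify.

Set Implicit Arguments.
Unset Strict Implicit.
Unset Printing Implicit Defensive.

Import GRing.Theory Num.Theory.

(* If row i lies below a strictly longer row j, the triple conditions force
   F i c < F j c.+1. Hence the entries of a column are distinct, and a tableau is
   determined by its sets of column entries.

   Rectangles and parts 1, 2: rotating a tableau by 180 degrees and complementing
   its entries does not give a tableau, but a greedy rearrangement inside each
   column does. This is a weight-reversing injection from the tableaux of shape a
   to those of shape rev a; the two cardinalities are equal by symmetry. When
   n = size a and adjacent parts differ by at most 1, the only tableau has
   constant rows.

   alpha = beta: each letter occurs at most once per column, so the truncated sums
   of min(w_v, C) dominate those of min(a_r, C); for a tableau of shape beta and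
   weight alpha they are all equal, which forces its rows to be constant.

   Necessity: up to reversal, alpha has adjacent parts a_i < a_(i+1). If they
   differ by at least 2, the weight of the row-constant tableau with one letter
   i+1 changed into i occurs in S_alpha but not in hat S_alpha. If they are k and
   k+1 with k >= 2 and n > size alpha, the weight
   (..., k-1, k+1, 1, ...), which replaces these two parts, occurs in hat S_alpha
   but not in S_alpha. *)

(* A filling as a function of row and column; only its values F r c with
   c < nth 0 a r matter. *)
Record ctab (a : seq nat) (F : nat -> nat -> nat) : Prop := Ctab {
  ctab_row : forall r c, c.+1 < nth 0 a r -> F r c.+1 <= F r c;
  ctab_col0 : forall i j, i < j -> j < size a -> F i 0 < F j 0;
  ctab_A : forall i j c, i < j -> c.+1 < nth 0 a j -> nth 0 a j <= nth 0 a i ->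
    F i c < F j c.+1 \/ F j c.+1 < F i c.+1;
  ctab_B : forall i j c, i < j -> c < nth 0 a i -> nth 0 a i < nth 0 a j ->
    F j c < F i c \/ F i c < F j c.+1 }.

Definition bounded n (a : seq nat) (F : nat -> nat -> nat) :=
  forall r c, c < nth 0 a r -> F r c < n.

Definition wt (a : seq nat) (F : nat -> nat -> nat) v :=
  \sum_(r < size a) \sum_(c < nth 0 a r) (F r c == v).

Lemma nth_gt0_size (a : seq nat) r c : c < nth 0 a r -> r < size a.
Proof. by rewrite ltnNge [r < _]ltnNge; apply: contra => h; rewrite nth_default. Qed.

Lemma composition_gt0 a r : is_composition a -> r < size a -> 0 < nth 0 a r.
Proof. by move=> /all_nthP h; apply: h. Qed.

(** * Order relations between the entries of a tableau *)

Section Ctab.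
Variables (a : seq nat) (F : nat -> nat -> nat).
Hypothesis ctF : ctab a F.

Lemma ctab_row_le r c c' : c <= c' -> c' < nth 0 a r -> F r c' <= F r c.
Proof.
elim: c' => [|c' IH] hc hc'; first by move: hc; rewrite leqn0 => /eqP ->.
move: hc; rewrite leq_eqVlt => /orP[/eqP -> //|hc].
apply: leq_trans (IH _ _) => //; last by apply: ltnW.
exact: (ctab_row ctF).
Qed.

(** The inequality [F i c < F j c] holds in column 0 and persists: it rules out the first
    alternative of [ctab_B], and the second one, with the weak decrease of row i, carries it to
    column [c.+1]. *)
Lemma ctab_longer i j c : i < j -> c < nth 0 a i -> nth 0 a i < nth 0 a j ->
  F i c < F j c.+1.
Proof.
move=> ij hc hij.
suff: F i c < F j c by case: (ctab_B ctF ij hc hij) => //; lia.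
elim: c hc => [|c IH] hc.
  by apply: (ctab_col0 ctF) => //; apply: (nth_gt0_size (c := 0)); lia.
have hc' : c < nth 0 a i by lia.
case: (ctab_B ctF ij hc' hij) => h; first by have := IH hc'; lia.
by have := ctab_row ctF hc; lia.
Qed.

(** Once both rows reach column [c.+1], the two types of triples lead to the same alternative, so
    later arguments need not compare row lengths. *)
Lemma ctab_next i j c : i < j -> c.+1 < nth 0 a i -> c.+1 < nth 0 a j ->
  F i c < F j c.+1 \/ F j c.+1 < F i c.+1.
Proof.
move=> ij hi hj; case: (leqP (nth 0 a j) (nth 0 a i)) => h.
  exact: (ctab_A ctF).
by left; apply: ctab_longer => //; lia.
Qed.

Lemma ctab_column_lt i j c : i < j -> c < nth 0 a i -> c < nth 0 a j ->
  F i c != F j c.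
Proof.
move=> ij; case: c => [|c] hi hj.
  by rewrite neq_ltn (ctab_col0 ctF) // (nth_gt0_size hj).
case: (ctab_next ij hi hj) => h; have := ctab_row ctF hi; lia.
Qed.

Lemma ctab_column_inj i j c : c < nth 0 a i -> c < nth 0 a j ->
  F i c = F j c -> i = j.
Proof.
move=> hi hj e; case: (ltngtP i j) => // ij.
  by have := ctab_column_lt ij hi hj; rewrite e eqxx.
by have := ctab_column_lt ij hj hi; rewrite e eqxx.
Qed.

Lemma ctab_entry_le r r' c : r <= r' -> r' < size a -> c < nth 0 a r ->
  F r c <= F r' 0.
Proof.
move=> hr hr' hc; apply: leq_trans (ctab_row_le (leq0n c) hc) _.
move: hr; rewrite leq_eqVlt => /orP[/eqP -> //|hr].
by apply: ltnW; apply: (ctab_col0 ctF).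
Qed.

Lemma ctab_col0_ge r : r < size a -> F 0 0 + r <= F r 0.
Proof.
elim: r => [|r IH] hr; first by lia.
by have := ctab_col0 ctF (ltnSn r) hr; have := IH (ltnW hr); lia.
Qed.

Lemma ctab_col0_step r d : r + d < size a -> F r 0 + d <= F (r + d) 0.
Proof.
elim: d => [|d IH] hr; first by rewrite !addn0.
have h1 : r + d < size a by lia.
have h2 : r + d < r + d.+1 by lia.
by have := ctab_col0 ctF h2 hr; have := IH h1; lia.
Qed.

End Ctab.

(** * Weights counted by letters, rows and columns *)

Lemma wt_gt0 a F r c : c < nth 0 a r -> 0 < wt a F (F r c).
Proof.
move=> hc; have hr := nth_gt0_size hc.
rewrite /wt (bigD1 (Ordinal hr)) //= (bigD1 (Ordinal hc)) //= eqxx; lia.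
Qed.

Lemma sum_eqn (x y : nat) : \sum_(v < x) (y == v) = (y < x).
Proof.
case: ltnP => h.
  rewrite (bigD1 (Ordinal h)) //= eqxx big1 // => i /negbTE hi.
  by apply/eqP; rewrite eqb0; apply: contraFN hi => /eqP e; apply/eqP/val_inj.
by rewrite big1 // => i _; apply/eqP; rewrite eqb0; have := ltn_ord i; lia.
Qed.

Lemma sum_wt_le a F x :
  \sum_(v < x) wt a F v = \sum_(r < size a) \sum_(c < nth 0 a r) (F r c < x).
Proof.
rewrite /wt exchange_big; apply: eq_bigr => r _.
by rewrite exchange_big; apply: eq_bigr => c _; rewrite sum_eqn.
Qed.

(** Serves as a capacity bound: rows whose entries all lie below x cannot have more boxes than
    letters below x have occurrences. *)
Lemma sum_rows_le_wt a F p x : p <= size a ->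
    (forall r c, r < p -> c < nth 0 a r -> F r c < x) ->
  \sum_(r < p) nth 0 a r + \sum_(r < size a | p <= r) \sum_(c < nth 0 a r) (F r c < x)
    = \sum_(v < x) wt a F v.
Proof.
move=> hp h; rewrite sum_wt_le.
rewrite [RHS](bigID (fun r : 'I_(size a) => p <= r)) /= addnC; congr (_ + _).
rewrite (big_ord_widen _ (fun r => nth 0 a r) hp).
apply: eq_big => [r|r hr]; first by rewrite -ltnNge.
rewrite -[LHS]muln1 -[X in X * _]card_ord -sum_nat_const.
by apply: eq_bigr => c _; rewrite h.
Qed.

Lemma sum_columns a (G : nat -> nat -> nat) K : (forall r, nth 0 a r <= K) ->
  \sum_(r < size a) \sum_(c < nth 0 a r) G r c
    = \sum_(c < K) \sum_(r < size a | c < nth 0 a r) G r c.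
Proof.
move=> hK; rewrite (exchange_big_dep xpredT) //=; apply: eq_bigr => r _.
by rewrite (big_ord_widen _ (fun c => G r c) (hK r)).
Qed.

Lemma wt_columns a F v K : (forall r, nth 0 a r <= K) ->
  wt a F v = \sum_(c < K) \sum_(r < size a | c < nth 0 a r) (F r c == v).
Proof. exact: (sum_columns (fun r c => (F r c == v) : nat)). Qed.

Lemma column_count_le1 a F v c : ctab a F ->
  \sum_(r < size a | c < nth 0 a r) (F r c == v) <= 1.
Proof.
move=> ctF.
case: (pickP (fun r : 'I_(size a) => (c < nth 0 a r) && (F r c == v))) => [r0|h].
  move=> /andP[h0 e0]; rewrite (bigD1 r0) //= big1 ?addn0 ?leq_b1 // => r.
  move=> /andP[hr ne]; apply/eqP; rewrite eqb0; apply: contra ne => /eqP e.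
  by apply/eqP/val_inj/(ctab_column_inj ctF hr h0); rewrite e (eqP e0).
by rewrite big1 // => r hr; apply/eqP; rewrite eqb0; have := h r; rewrite hr /= => ->.
Qed.

(** * Column sets and the rearrangement of columns *)

(** Matching equal values gives a strictly increasing self-map of l indices, which can only be the
    identity. *)
Lemma increasing_eq l (f g : nat -> nat) :
    (forall i j, i < j -> j < l -> f i < f j) ->
    (forall i j, i < j -> j < l -> g i < g j) ->
    (forall i, i < l -> exists2 j, j < l & f i = g j) ->
  forall i, i < l -> f i = g i.
Proof.
move=> hf hg hfg.
have [t ht] : exists t : 'I_l -> 'I_l, forall i : 'I_l, f i = g (t i).
  apply: (@fin_all_exists 'I_l (fun=> 'I_l) (fun i j => f i = g j)) => i.
  by case: (hfg i (ltn_ord i)) => j hj e; exists (Ordinal hj).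
have mono (i j : 'I_l) : i < j -> t i < t j.
  move=> ij; rewrite ltnNge leq_eqVlt; apply/negP => /orP[/eqP e|h].
    by have := hf _ _ ij (ltn_ord j); rewrite !ht e ltnn.
  have := hf _ _ ij (ltn_ord j); rewrite !ht.
  by have := hg _ _ h (ltn_ord _); lia.
have ge m (hm : m < l) : m <= t (Ordinal hm).
  elim: m hm => // m IH hm; have hm' : m < l by lia.
  apply: leq_ltn_trans (IH hm') _; exact: mono.
have le d : forall i : 'I_l, i + d = l.-1 -> t i + d <= l.-1.
  elim: d => [|d IH] i hi; first by have := ltn_ord (t i); lia.
  have hi' : i.+1 < l by have := ltn_ord i; lia.
  have := IH (Ordinal hi') ltac:(rewrite /=; lia).
  by have := mono i (Ordinal hi') (ltnSn i); lia.
move=> i hi; rewrite (ht (Ordinal hi)); congr g.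
have := ge i hi; have := le (l.-1 - i) (Ordinal hi) ltac:(rewrite /=; lia).
by rewrite /=; lia.
Qed.

(* Among the entries of column c.+1 not yet placed in lower rows, row i must
   receive the largest one that is at most F i c. *)
Lemma ctab_determined_by_columns a F G : ctab a F -> ctab a G ->
    (forall r c, c < nth 0 a r -> exists2 r', c < nth 0 a r' & F r c = G r' c) ->
    (forall r c, c < nth 0 a r -> exists2 r', c < nth 0 a r' & G r c = F r' c) ->
    is_composition a ->
  forall r c, c < nth 0 a r -> F r c = G r c.
Proof.
move=> ctF ctG FG GF ca r c; elim: c r => [|c IHc] r hr.
  apply: (@increasing_eq (size a) (F^~ 0) (G^~ 0)); last exact: nth_gt0_size hr.
  - exact: ctab_col0 ctF.
  - exact: ctab_col0 ctG.
  move=> i hi; case: (FG i 0 (composition_gt0 ca hi)) => j /nth_gt0_size hj e.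
  by exists j.
elim/ltn_ind: r hr => r IHr hr.
(* The larger entry [F2 r c.+1] sits in some row j of [F1]: for j below r it is already placed, for
   j above r it violates [ctab_next] in [F1]. *)
have aux F1 F2 : ctab a F1 -> ctab a F2 ->
    (forall r c, c < nth 0 a r -> exists2 r', c < nth 0 a r' & F2 r c = F1 r' c) ->
    F1 r c = F2 r c ->
    (forall m, m < r -> c.+1 < nth 0 a m -> F1 m c.+1 = F2 m c.+1) ->
    ~~ (F1 r c.+1 < F2 r c.+1).
  move=> ct1 ct2 h21 e0 IH; apply/negP => lt12.
  case: (h21 r c.+1 hr) => j hj e.
  have := ctab_row ct2 hr; case: (ltngtP j r) => jr.
  - have := IH j jr hj; rewrite -e => /(ctab_column_inj ct2 hr hj); lia.
  - by case: (ctab_next ct1 jr hr hj); rewrite -e; lia.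
  - by move: lt12; rewrite e jr ltnn.
have hc : c < nth 0 a r by lia.
have := aux F G ctF ctG GF (IHc _ hc) IHr.
have := aux G F ctG ctF FG (esym (IHc _ hc)) (fun m h1 h2 => esym (IHr m h1 h2)).
lia.
Qed.

(** One step of the rearrangement: f is the column already built, g holds the entries of the next
    one, and D is the set of rows that reach it. From the bottom up, each row of D takes the largest
    remaining entry that its f allows. *)
Lemma greedy_column l (f g : 'I_l -> nat) (D : {set 'I_l}) :
    {in D &, injective g} ->
    (forall r, r \in D -> g r <= f r) ->
    (forall i j : 'I_l, i < j -> i \notin D -> j \in D -> f i < g j) ->
    (forall i j : 'I_l, i < j -> i \in D -> j \notin D -> f i < f j) ->
  exists s : {perm 'I_l}, [/\ forall r, (s r \in D) = (r \in D),
    forall r, r \notin D -> s r = r,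
    forall r, r \in D -> g (s r) <= f r &
    forall i j : 'I_l, i < j -> j \in D ->
      f i < g (s j) \/ (i \in D) /\ g (s j) < g (s i)].
Proof.
move=> ginj gf h1 h2.
(* After m rounds the rows below m are final; the fourth clause is an invariant on rows outside D
   that every swap must preserve. *)
have main m : m <= l -> exists s : {perm 'I_l},
    [/\ forall r, (s r \in D) = (r \in D),
    forall r, r \notin D -> s r = r,
    forall r, r \in D -> g (s r) <= f r,
    forall i j : 'I_l, i < j -> i \notin D -> j \in D -> f i < g (s j) &
    forall i j : 'I_l, i < m -> i < j -> i \in D -> j \in D ->
      f i < g (s j) \/ g (s j) < g (s i)]; last first.
  case: (main l (leqnn l)) => s [sD sN sf sh sm].
  exists s; split=> // i j ij jD; case: (boolP (i \in D)) => iD; last by left; auto.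
  by case: (sm i j (ltn_ord i) ij iD jD); auto.
elim: m => [|m IH] hm.
  exists 1%g; split=> // [r|r _|r|i j]; rewrite ?perm1 //; [exact: gf|exact: h1].
case: (IH (ltnW hm)) => s [sD sN sf sh sm] {IH}.
pose m0 := Ordinal hm.
case: (boolP (m0 \in D)) => mD; last first.
  exists s; split=> // i j; rewrite ltnS leq_eqVlt => /orP[/eqP e ij iD|]; last exact: sm.
  by move: mD; rewrite (_ : m0 = i) ?iD //; apply: val_inj.
pose P j := [&& j \in D, m <= j & g (s j) <= f m0].
have Pm : P m0 by rewrite /P mD leqnn sf.
(* Row j holds the entry that row m should receive; the two rows exchange entries. *)
case: (arg_maxnP (fun j => g (s j)) Pm) => j /and3P[jD mj jf] jmax {Pm}.
pose t := tperm m0 j.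
have tD r : (t r \in D) = (r \in D).
  by rewrite /t; case: tpermP => [->|->|]; rewrite ?mD ?jD.
have tge (r : 'I_l) : m <= r -> m <= t r.
  by rewrite /t; case: tpermP => [->|->|] //.
have tlt (r : 'I_l) : r < m -> t r = r.
  by move=> hr; rewrite /t tpermD //; apply/eqP => e; move: hr; rewrite -e /=; lia.
exists (t * s)%g; split.
- by move=> r; rewrite permM sD tD.
- move=> r rD; rewrite permM /t tpermD ?sN //; apply: contraNneq rD => <- //.
- move=> r rD; rewrite permM /t; case: tpermP => [-> //|e|_ _]; last exact: sf.
  subst r.
  apply: leq_trans (sf j jD); apply: jmax; by rewrite /P mD leqnn sf.
- move=> i r ir iD rD; rewrite permM /t; case: tpermP => [e|e|_ _]; last exact: sh.
    by apply: sh => //; subst r; move: ir => /= ir; exact: leq_trans ir mj.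
  subst r; case: (ltnP i m) => im; first exact: sh.
  (* A row i outside D between m and j would give [f m0 < f i < g (s j) <= f m0]. *)
  have mi : m0 < i.
    rewrite /= ltn_neqAle im andbT; apply: contraNneq iD => e.
    by rewrite (_ : i = m0) //; apply: val_inj.
  have := h2 m0 i mi mD iD; have := sh i j ir iD jD.
  have := jf; lia.
- move=> i r hi ir iD rD; rewrite !permM.
  move: hi; rewrite ltnS leq_eqVlt => /orP[/eqP e|hi].
    have ei : i = m0 by apply: val_inj.
    subst i; rewrite {3}/t tpermL.
    have tr : m <= t r by apply/tge/ltnW.
    case: (leqP (g (s (t r))) (f m0)) => h; [right|by left].
    have := jmax (t r); rewrite /P tD rD h tr /= => /(_ isT) hle.
    rewrite ltn_neqAle hle andbT; apply/eqP.
    move=> /ginj; rewrite !sD tD rD jD => /(_ isT isT) /perm_inj e1.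
    by move: ir; rewrite -(tpermK m0 j r) -/t e1 /t tpermR /= ltnn.
  rewrite (tlt i) //; apply: sm => //; rewrite ?tD //.
  case: (leqP m r) => mr; first exact: leq_trans hi (tge _ mr).
  by rewrite tlt.
Qed.

(** * Rotation of tableaux with all parts equal or all parts 1 or 2 *)

Lemma part_bound (a : seq nat) : exists K, forall r, nth 0 a r <= K.
Proof.
exists (\max_(r < size a) nth 0 a r) => r.
case: (ltnP r (size a)) => hr; last by rewrite nth_default.
exact: (leq_bigmax (Ordinal hr)).
Qed.

Lemma sum_ltn l i : \sum_(r < l) (i < r : nat) = l - i.+1.
Proof.
elim: l => [|l IH]; first by rewrite big_ord0; lia.
by rewrite big_ord_recr /= IH; lia.
Qed.

(* F' has in its c-th column the complements of the entries of F that lie c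
   places before the end of their row, moved among rows of equal length. *)
Definition rotated n a (F F' : nat -> nat -> nat) := forall c,
  exists p : {perm 'I_(size a)}, forall r : 'I_(size a),
    nth 0 (rev a) r = nth 0 a (p r) /\
    (c < nth 0 (rev a) r ->
      F' r c = n.-1 - F (p r) ((nth 0 (rev a) r).-1 - c)).

(** Column c of [F'] permutes the boxes lying c places before the row ends; over all c these exhaust
    the diagram, and complementation exchanges v and [n.-1 - v]. *)
Lemma rotated_wt n a F F' v : rotated n a F F' -> bounded n a F -> v < n ->
  wt (rev a) F' v = wt a F (n.-1 - v).
Proof.
move=> rot bF hv; case: (part_bound a) => K hK.
have hK' r : nth 0 (rev a) r <= K.
  case: (ltnP r (size a)) => hr; last by rewrite nth_default // size_rev.
  by rewrite nth_rev.
rewrite /wt (sum_columns (fun r c => (F' r c == v) : nat) hK') size_rev.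
transitivity (\sum_(c < K) \sum_(r < size a | c < nth 0 a r)
    (n.-1 - F r ((nth 0 a r).-1 - c) == v)).
  apply: eq_bigr => c _; case: (rot c) => p hp.
  rewrite [RHS](reindex_inj (@perm_inj _ p)) /=.
  apply: eq_big => [r|r]; first by case: (hp r) => ->.
  by move=> hc; case: (hp r) => e h; rewrite h // e.
rewrite -(sum_columns (fun r c => (n.-1 - F r ((nth 0 a r).-1 - c) == v) : nat) hK).
apply: eq_bigr => r _; rewrite (reindex_inj rev_ord_inj) /=.
apply: eq_bigr => c _; congr (nat_of_bool _).
have -> : (nth 0 a r).-1 - (nth 0 a r - c.+1) = c by have := ltn_ord c; lia.
by have := bF r c (ltn_ord c); lia.
Qed.

(** Rows matched through [F'] have equal length, so equal distances from the end mean equal columns.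
    Hence [F1] and [F2] have the same column sets, which determine a tableau. *)
Lemma rotated_inj n a F1 F2 F' : is_composition a -> ctab a F1 -> ctab a F2 ->
    bounded n a F1 -> bounded n a F2 -> rotated n a F1 F' -> rotated n a F2 F' ->
  forall r c, c < nth 0 a r -> F1 r c = F2 r c.
Proof.
move=> ca ct1 ct2 b1 b2 r1 r2.
have aux G1 G2 : bounded n a G1 -> bounded n a G2 ->
    rotated n a G1 F' -> rotated n a G2 F' -> forall r c, c < nth 0 a r ->
    exists2 r', c < nth 0 a r' & G1 r c = G2 r' c.
  move=> bG1 bG2 rot1 rot2 r c hc; have hr := nth_gt0_size hc.
  case: (rot1 ((nth 0 a r).-1 - c)) => p hp; case: (rot2 ((nth 0 a r).-1 - c)) => q hq.
  pose s := (p^-1)%g (Ordinal hr).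
  have := hp s; rewrite permKV /= => -[e1 h1]; have := hq s => -[e2 h2].
  rewrite e1 in h1 h2 e2.
  have ec : (nth 0 a r).-1 - ((nth 0 a r).-1 - c) = c by lia.
  exists (q s); first by rewrite -e2.
  have h : (nth 0 a r).-1 - c < nth 0 a r by lia.
  have := h1 h; rewrite (h2 h) ec.
  have hc2 : c < nth 0 a (q s) by rewrite -e2.
  by have := bG1 _ _ hc; have := bG2 _ _ hc2; lia.
by apply: ctab_determined_by_columns => //; apply: aux.
Qed.

Definition extend_ord l (f : 'I_l -> nat) r := if insub r is Some i then f i else 0.

Lemma extend_ordE l (f : 'I_l -> nat) (i : 'I_l) : extend_ord f i = f i.
Proof. by rewrite /extend_ord valK. Qed.

Section Rotation.
Variables (n k : nat) (a : seq nat) (F : nat -> nat -> nat).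
Hypotheses (ca : is_composition a) (ctF : ctab a F) (bF : bounded n a F).
(** Treats both families at once: all parts equal to k, or parts 1 and 2 with k = 2. *)
Hypothesis parts : forall r, r < size a -> nth 0 a r = k \/ nth 0 a r = 1 /\ k = 2.

Local Notation l := (size a).
Local Notation b := (nth 0 (rev a)).
Local Notation A := (nth 0 a).

(** The complements of these entries form the first column of the rotated tableau. *)
Let lst r := F r (A r).-1.

Let lst_bound r : r < l -> lst r < n.
Proof. by move=> hr; apply: bF; have := composition_gt0 ca hr; lia. Qed.

Let lst_ltl i j : i < j -> j < l -> A i <> k -> lst i < lst j.
Proof.
move=> ij jl ik; have il : i < l by lia.
rewrite /lst; case: (parts il) => // -[ei k2].
case: (parts jl) => [ej|[ej _]]; rewrite ei ej /=.
  by rewrite k2; apply: (ctab_longer ctF ij); lia.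
exact: (ctab_col0 ctF).
Qed.

Let lst_ltr i j : i < j -> j < l -> A j <> k -> lst i < lst j.
Proof.
move=> ij jl jk; have il : i < l by lia.
have i0 := composition_gt0 ca il.
rewrite /lst; case: (parts jl) => // -[ej k2]; rewrite ej /=.
apply: leq_ltn_trans (ctab_col0 ctF ij jl).
by apply: (ctab_row_le ctF) => //; lia.
Qed.

Let lst_inj (i j : 'I_l) : lst i = lst j -> i = j.
Proof.
move=> e; apply: val_inj => /=.
case: (eqVneq (A i) k) => [ik|/eqP ik].
  case: (eqVneq (A j) k) => [jk|/eqP jk].
    have := composition_gt0 ca (ltn_ord i); have := composition_gt0 ca (ltn_ord j).
    move=> hj hi; apply: (ctab_column_inj (c := k.-1) ctF); [lia|lia|].
    by move: e; rewrite /lst ik jk.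
  case: (ltngtP i j) => // h; first by have := lst_ltr h (ltn_ord j) jk; lia.
  by have := lst_ltl h (ltn_ord i) jk; lia.
case: (ltngtP i j) => // h; first by have := lst_ltl h (ltn_ord j) ik; lia.
by have := lst_ltr h (ltn_ord i) ik; lia.
Qed.

Let bE (r : 'I_l) : b r = A (l - r.+1).
Proof. by rewrite nth_rev. Qed.

(** Sorting by decreasing last entry reverses the shape: a row of length other than k has smaller
    last entries below it and larger ones above it, so its rank is its position from the top. The
    remaining rows all have length k. *)
Lemma sorting_perm : exists p : {perm 'I_l},
  (forall r : 'I_l, b r = A (p r)) /\
  (forall i j : 'I_l, i < j -> lst (p j) < lst (p i)).
Proof.
pose rk (r : 'I_l) := #|[set x : 'I_l | lst r < lst x]|.
have rk_mono (x y : 'I_l) : lst x < lst y -> rk y < rk x.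
  move=> h; apply: proper_card; apply/properP; split.
    by apply/subsetP => z; rewrite !inE; lia.
  by exists y; rewrite !inE ?ltnn.
have rk_lt r : rk r < l.
  rewrite -[X in _ < X]card_ord; apply: proper_card; apply/properP; split.
    exact/subsetP.
  by exists r; rewrite ?inE ?ltnn.
have rk1 (r : 'I_l) : A r <> k -> rk r = l - r.+1.
  move=> hr; rewrite -sum_ltn /rk -sum1dep_card big_mkcond /=.
  apply: eq_bigr => x _; case: (ltngtP r x) => h.
  - by rewrite lst_ltl.
  - by rewrite ltnNge ltnW // lst_ltr.
  - by rewrite h ltnn.
pose q r := Ordinal (rk_lt r).
have q_inj : injective q.
  move=> x y /(congr1 val) /= e; apply: lst_inj.
  by case: (ltngtP (lst x) (lst y)) => // /rk_mono; lia.
pose p : {perm 'I_l} := ((perm q_inj)^-1)%g.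
have qp (r : 'I_l) : q (p r) = r by rewrite -[RHS](permKV (perm q_inj)) permE.
have rkp (r : 'I_l) : rk (p r) = r by have := congr1 val (qp r).
exists p; split=> [r|i j ij]; last first.
  rewrite ltnNge leq_eqVlt; apply/negP => /orP[/eqP/lst_inj/perm_inj e|/rk_mono h].
    by rewrite e ltnn in ij.
  by move: h; rewrite !rkp; lia.
have hr := ltn_ord r.
case: (eqVneq (A (p r)) k) => [pk|/eqP pk]; last first.
  have := rkp r; rewrite rk1 // bE => er; congr nth.
  by have := ltn_ord (p r); lia.
rewrite bE pk; have hl : l - r.+1 < l by lia.
case: (eqVneq (A (l - r.+1)) k) => // /eqP xk.
have e : rk (Ordinal hl) = r by rewrite rk1 //=; lia.
have : q (Ordinal hl) = q (p r) by apply: val_inj; rewrite /= e rkp.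
by move/q_inj => ep; case: xk; rewrite -pk -ep.
Qed.

Let b_parts (r : 'I_l) : b r = k \/ b r = 1 /\ k = 2.
Proof. by rewrite bE; apply: parts; have := ltn_ord r; lia. Qed.

(** Columns are built from left to right: sorting the last entries gives column 0, [greedy_column]
    each later one. The last clause holds both triple conditions, since a lower row that stops early
    leaves only its first alternative. *)
Lemma rotation_columns C : exists F' : nat -> nat -> nat,
  [/\ forall c, exists p : {perm 'I_l}, forall r : 'I_l, b r = A (p r) /\
        (c <= C -> c < b r -> F' r c = n.-1 - F (p r) ((b r).-1 - c)),
      forall i j : 'I_l, i < j -> F' i 0 < F' j 0 &
      forall c, c < C -> forall j : 'I_l, c.+1 < b j -> F' j c.+1 <= F' j c /\
        forall i : 'I_l, i < j ->
          F' i c < F' j c.+1 \/ c.+1 < b i /\ F' j c.+1 < F' i c.+1].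
Proof.
elim: C => [|C [F' [rot col0 step]]].
  case: sorting_perm => p [bp pl].
  exists (fun r _ => extend_ord (fun i => n.-1 - lst (p i)) r); split=> // [c|i j ij].
    exists p => r; split=> // c0 hr; rewrite extend_ordE /lst -bp.
    by move: c0; rewrite leqn0 => /eqP ->; rewrite subn0.
  rewrite !extend_ordE; have := pl i j ij.
  by have := lst_bound (ltn_ord (p i)); have := lst_bound (ltn_ord (p j)); lia.
case: (rot C) => p hp.
pose D := [set i : 'I_l | C.+1 < b i].
pose g (i : 'I_l) := n.-1 - F (p i) ((b i).-1 - C.+1).
have Dk i : i \in D -> b i = k by rewrite inE; case: (b_parts i) => // -[->]; lia.
have F'C (i : 'I_l) : C < b i -> F' i C = n.-1 - F (p i) ((b i).-1 - C).
  by move=> h; case: (hp i) => _ /(_ (leqnn C) h).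
have bp (i : 'I_l) : b i = A (p i) by case: (hp i).
have Fb (i : 'I_l) c : c < b i -> F (p i) c < n by rewrite bp; apply: bF.
have g_inj : {in D &, injective g}.
  move=> i j iD jD; rewrite /g (Dk i iD) (Dk j jD) => e.
  have ik := Dk i iD; have jk := Dk j jD; move: iD jD; rewrite !inE => iD jD.
  apply/(@perm_inj _ p)/val_inj/(ctab_column_inj (c := k.-1 - C.+1) ctF).
  - by rewrite -bp; lia.
  - by rewrite -bp; lia.
  - have B1 : F (p i) (k.-1 - C.+1) < n by apply: Fb; lia.
    have B2 : F (p j) (k.-1 - C.+1) < n by apply: Fb; lia.
    by rewrite /=; lia.
have gf r : r \in D -> g r <= F' r C.
  rewrite inE => rD; rewrite F'C; last by lia.
  apply: leq_sub2l; apply: (ctab_row_le ctF); [lia|by rewrite -bp; lia].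
(* A row can stop while another goes on only if it has length 1, hence only at column 0. *)
have C0 (i j : 'I_l) : i \notin D -> j \in D -> [/\ C = 0, b i = 1 & k = 2].
  move=> iD jD; have jk := Dk j jD; move: iD jD; rewrite !inE.
  by case: (b_parts i) => [|[? ?]] ? ?; [lia|split; lia].
have h1 (i j : 'I_l) : i < j -> i \notin D -> j \in D -> F' i C < g j.
  move=> ij iD jD; have jk := Dk j jD; case: (C0 i j iD jD) => eC bi k2; subst C.
  have := col0 i j ij; rewrite /g !F'C; try lia.
  rewrite bi jk k2 /= !subn0 subnn => lt1.
  have B1 : F (p i) 0 < n by apply: Fb; lia.
  have B2 : F (p j) 0 < n by apply: Fb; lia.
  have B3 : F (p j) 1 < n by apply: Fb; lia.
  (* Otherwise the row [p j] of length 2 lies above the row [p i] of length 1, and [ctab_longer]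
     contradicts the order of the last entries. *)
  suff : p j < p i.
    by move/(ctab_col0 ctF)/(_ (ltn_ord (p i))); lia.
  case: (ltngtP (p j) (p i)) => // [h|/val_inj/perm_inj e]; last by rewrite e ltnn in ij.
  have := ctab_longer ctF (c := 0) h; rewrite -!bp bi jk k2 => /(_ isT isT).
  by lia.
have h2 (i j : 'I_l) : i < j -> i \in D -> j \notin D -> F' i C < F' j C.
  by move=> ij iD jD; case: (C0 j i jD iD) => -> _ _; apply: col0.
case: (greedy_column (f := fun i : 'I_l => F' i C) g_inj gf h1 h2) => s [sD sN sf sm].
exists (fun r c => if c == C.+1 then extend_ord (g \o s) r else F' r c); split.
- move=> c; case: (eqVneq c C.+1) => [->|nc].
    exists (s * p)%g => r; rewrite permM -bp extend_ordE.
    have e : b (s r) = b r.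
      case: (boolP (r \in D)) => rD; last by rewrite sN.
      by rewrite (Dk r rD) Dk ?sD.
    by rewrite e; split=> // _ _; rewrite /= /g e.
  case: (rot c) => p' hp'; exists p' => r; case: (hp' r) => e h; split=> // hc hb.
  by apply: h => //; lia.
- exact: col0.
- move=> c; rewrite ltnS leq_eqVlt => /orP[/eqP ->|hc] j hj; last first.
    by rewrite eqSS (ltn_eqF hc) (ltn_eqF (leqW hc)); exact: step.
  rewrite eqxx (ltn_eqF (ltnSn C)).
  have jD : j \in D by rewrite inE.
  rewrite extend_ordE; split=> [|i ij]; first exact: sf.
  rewrite extend_ordE; case: (sm i j ij jD) => [|[iD h]]; first by left.
  by right; move: iD; rewrite inE.
Qed.

Lemma rotation_exists : exists F',
  [/\ ctab (rev a) F', bounded n (rev a) F' & rotated n a F F'].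
Proof.
case: (rotation_columns k) => F' [rot col0 step].
have bk (r : 'I_l) : b r <= k by case: (b_parts r); lia.
have ord r c : c < b r -> exists2 i : 'I_l, r = i & c < b i.
  by move=> h; have := nth_gt0_size h; rewrite size_rev => hr; exists (Ordinal hr).
exists F'; split.
- split.
  + move=> r c /ord[i -> hi]; have := bk i => h.
    by case: (step c _ i hi); lia.
  + by move=> i j ij; rewrite size_rev => hj;
      apply: (col0 (Ordinal (ltn_trans ij hj)) (Ordinal hj)).
  + move=> i j c ij hj hij.
    have : c.+1 < b i by apply: leq_trans hij.
    case/ord=> i' ei _; case/ord: (hj) => j' ej _; subst i j.
    have cC : c < k by have := bk j'; lia.
    by case: (step c cC j' hj) => _ /(_ i' ij)[|[]]; auto.
  + move=> i j c ij hi hij.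
    case/ord: (hi) => i' ei _; subst i.
    have hj : b i' < b j by [].
    case/ord: (hj) => j' ej _; subst j.
    have [i1 k2] : b i' = 1 /\ k = 2 by have := bk j'; case: (b_parts i') => //; lia.
    have c0 : c = 0 by lia.
    subst c; rewrite i1 in hij hi hj.
    have k0 : 0 < k by lia.
    by case: (step 0 k0 j' hij) => _ /(_ i' ij)[|[]]; auto; rewrite i1.
- move=> r c /ord[i -> hi]; case: (rot c) => p hp; case: (hp i) => e h.
  rewrite h //; last by have := bk i; lia.
  have : F (p i) 0 < n by apply: bF; rewrite -e; lia.
  by lia.
- move=> c; case: (rot c) => p hp; exists p => r; case: (hp r) => e h; split=> // hc.
  by apply: h => //; have := bk r; lia.
Qed.

End Rotation.

(** * Coefficients as numbers of tableaux *)

Section Tableaux.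
Variables (n : nat) (a : seq nat).
Implicit Types T : {ffun box a -> 'I_n}.

(** Frees the combinatorics from the dependent type of boxes; the value 0 is a filler outside the
    diagram. *)
Definition tab T r c : nat :=
  if insub r is Some i then
    if insub c is Some j then T (existT (fun i : 'I_(size a) => 'I_(nth 0 a i)) i j)
    else 0
  else 0.

Lemma tab_box T (x : box a) : tab T (row_of x) (col_of x) = T x.
Proof. by case: x => i j; rewrite /tab /row_of /col_of /= !valK. Qed.

Lemma col_lt (x : box a) : col_of x < nth 0 a (row_of x).
Proof. by case: x => i j; rewrite /col_of /row_of /= ltn_ord. Qed.

Lemma box_of r c : c < nth 0 a r -> exists x : box a, row_of x = r /\ col_of x = c.
Proof.
move=> hc; have hr := nth_gt0_size hc.
by exists (existT (fun i : 'I_(size a) => 'I_(nth 0 a i)) (Ordinal hr) (Ordinal hc)).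
Qed.

Lemma tab_inj T1 T2 :
  (forall r c, c < nth 0 a r -> tab T1 r c = tab T2 r c) -> T1 = T2.
Proof.
by move=> h; apply/ffunP => x; apply: val_inj; rewrite /= -!tab_box h ?col_lt.
Qed.

Lemma tab_bounded T : bounded n a (tab T).
Proof. by move=> r c /box_of[x [<- <-]]; rewrite tab_box. Qed.

Lemma ctab_tab T : is_composition a -> composition_tableau T -> ctab a (tab T).
Proof.
move=> ca /and3P[/forallP rows /forallP col0 /forallP trip]; split.
- move=> r c hc; case: (box_of hc) => y [ry cy].
  case: (box_of (ltnW hc)) => x [rx cx].
  rewrite -[tab T r c.+1](congr2 (tab T) ry cy) -[tab T r c](congr2 (tab T) rx cx) !tab_box.
  move: (rows x) => /forallP/(_ y)/implyP; apply.
  by rewrite rx ry cx cy eqxx ltnSn.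
- move=> i j ij hj; case: (box_of (composition_gt0 ca hj)) => y [ry cy].
  case: (box_of (composition_gt0 ca (ltn_trans ij hj))) => x [rx cx].
  rewrite -[tab T i 0](congr2 (tab T) rx cx) -[tab T j 0](congr2 (tab T) ry cy) !tab_box.
  by move: (col0 x) => /forallP/(_ y)/implyP; apply; rewrite rx ry cx cy eqxx.
- move=> i j c ij hj hij.
  have hi : c.+1 < nth 0 a i by apply: leq_trans hij.
  case: (box_of hj) => y [ry cy]; case: (box_of hi) => x [rx cx].
  case: (box_of (ltnW hi)) => z [rz cz].
  move: (trip z) => /forallP/(_ x)/forallP/(_ y)/implyP.
  rewrite /typeA_triple /adjacent /row_len rx ry rz cx cy cz !eqxx ij hij => /(_ isT).
  rewrite /inversion_triple -!tab_box rx ry rz cx cy cz; lia.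
- move=> i j c ij hi hij.
  have hj : c.+1 < nth 0 a j by apply: leq_trans hij.
  case: (box_of hj) => x [rx cx]; case: (box_of hi) => y [ry cy].
  case: (box_of (ltnW hj)) => z [rz cz].
  move: (trip z) => /forallP/(_ x)/forallP/(_ y)/implyP.
  rewrite /typeB_triple /adjacent /row_len rx ry rz cx cy cz !eqxx ij hij orbT => /(_ isT).
  rewrite /inversion_triple -!tab_box rx ry rz cx cy cz; lia.
Qed.

Lemma tableau_of_ctab F : ctab a F -> bounded n a F ->
  exists2 T : {ffun box a -> 'I_n}, composition_tableau T &
    forall r c, c < nth 0 a r -> tab T r c = F r c.
Proof.
move=> ctF bF.
pose T : {ffun box a -> 'I_n} := [ffun x => Ordinal (bF _ _ (col_lt x))].
have TE x : T x = F (row_of x) (col_of x) :> nat by rewrite ffunE.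
exists T; last by move=> r c /box_of[x [<- <-]]; rewrite tab_box TE.
apply/and3P; split.
- apply/forallP => x; apply/forallP => y; apply/implyP => /andP[/eqP e h].
  rewrite !TE e; apply: (ctab_row_le ctF) (ltnW h) _; exact: col_lt.
- apply/forallP => x; apply/forallP => y; apply/implyP => /and3P[/eqP ex /eqP ey h].
  by rewrite !TE ex ey; apply: (ctab_col0 ctF) => //; apply: nth_gt0_size (col_lt y).
- apply/forallP => z; apply/forallP => x; apply/forallP => y; apply/implyP.
  rewrite /inversion_triple !TE.
  have hx := col_lt x; have hy := col_lt y; have hz := col_lt z.
  case/orP=> /and4P[/andP[/eqP ezx /eqP ex] /eqP ey h1 h2].
    rewrite ey ex ezx; rewrite ey ex in hy.
    by case: (ctab_A ctF h1 hy h2); lia.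
  rewrite ey ex -ezx; rewrite ey in hy.
  by case: (ctab_B ctF h1 hy h2); lia.
Qed.

Definition content T : 'X_{1..n} := (\sum_(x : box a) U_(T x))%MM.

Lemma contentE T v : content T v = wt a (tab T) v.
Proof.
rewrite /content mnm_sumE /wt.
rewrite (eq_bigr (fun i : 'I_(size a) => \sum_(j < nth 0 a i | true)
  (T (existT (fun i : 'I_(size a) => 'I_(nth 0 a i)) i j) == v :> nat))); last first.
  by move=> i _; apply: eq_bigr => j _; rewrite /tab !valK.
rewrite (sig_big_dep _ _ (fun i j =>
  (T (existT (fun i : 'I_(size a) => 'I_(nth 0 a i)) i j) == v :> nat) : nat)) /=.
by apply: eq_bigr => -[i j] _; rewrite mnm1E.
Qed.

Definition tableaux (m : 'X_{1..n}) :=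
  [set T : {ffun box a -> 'I_n} | composition_tableau T & content T == m].

End Tableaux.

Lemma wt_ext a F G v : (forall r c, c < nth 0 a r -> F r c = G r c) ->
  wt a F v = wt a G v.
Proof. by move=> h; apply: eq_bigr => r _; apply: eq_bigr => c _; rewrite h. Qed.

Definition rev_mnm n (m : 'X_{1..n}) : 'X_{1..n} := [multinom m (rev_ord i) | i < n].

Lemma rev_mnmK n : involutive (@rev_mnm n).
Proof. by move=> m; apply/mnmP => i; rewrite !mnmE rev_ordK. Qed.

Lemma mpolyX_sum n (I : finType) (f : I -> 'X_{1..n}) :
  (\prod_(x : I) 'X_[f x] = 'X_[\sum_(x : I) f x]%MM :> {mpoly int[n]})%R.
Proof. by rewrite (big_morph _ (@mpolyXD _ _) (@mpolyX0 _ _)). Qed.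

Lemma mcoeff_quasisymmetric_schur n a m :
  ((quasisymmetric_schur n a)@_m = #|tableaux a m|%:R)%R.
Proof.
rewrite raddf_sum /tableaux -sum1dep_card natr_sum [RHS]big_mkcondr /=.
apply: eq_bigr => T _.
by rewrite mpolyX_sum mcoeffX; case: eqP.
Qed.

Lemma mcoeff_young_quasisymmetric_schur n a m :
  ((young_quasisymmetric_schur n a)@_m = #|tableaux (rev a) (rev_mnm m)|%:R)%R.
Proof.
rewrite /young_quasisymmetric_schur /quasisymmetric_schur.
rewrite (raddf_sum (comp_mpoly [tuple 'X_(rev_ord i) | i < n])) raddf_sum.
rewrite /tableaux -sum1dep_card natr_sum [RHS]big_mkcondr /=; apply: eq_bigr => T _.
rewrite rmorph_prod /= (eq_bigr (fun x => 'X_[U_(rev_ord (T x))])%R); last first.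
  by move=> x _; rewrite comp_mpolyXU -tnth_nth tnth_mktuple.
rewrite mpolyX_sum mcoeffX (_ : (\sum_x U_(rev_ord (T x)))%MM = rev_mnm (content T)).
  by rewrite (can2_eq (@rev_mnmK n) (@rev_mnmK n)); case: eqP.
apply/mnmP => i; rewrite mnmE !mnm_sumE; apply: eq_bigr => x _.
by rewrite !mnm1E (can2_eq rev_ordK rev_ordK).
Qed.

Lemma young_eq_quasisymmetric_schur n a b :
  young_quasisymmetric_schur n a = quasisymmetric_schur n b <->
  forall m : 'X_{1..n}, #|tableaux (rev a) (rev_mnm m)| = #|tableaux b m|.
Proof.
split=> [e m|h]; last first.
  apply/mpolyP => m.
  by rewrite mcoeff_quasisymmetric_schur mcoeff_young_quasisymmetric_schur h.
have /eqP := congr1 (fun p => (p@_m)%R) e.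
rewrite mcoeff_quasisymmetric_schur mcoeff_young_quasisymmetric_schur.
by rewrite eqr_nat => /eqP.
Qed.

Lemma tableaux_gt0 n a (m : 'X_{1..n}) : is_composition a ->
  0 < #|tableaux a m| <->
  exists F, [/\ ctab a F, bounded n a F & forall v : 'I_n, wt a F v = m v].
Proof.
move=> ca; split=> [/card_gt0P[T]|[F [ctF bF wF]]].
  rewrite inE => /andP[hT /eqP <-]; exists (tab T); split.
  - exact: ctab_tab.
  - exact: tab_bounded.
  - by move=> v; rewrite contentE.
case: (tableau_of_ctab ctF bF) => T hT e; apply/card_gt0P; exists T.
rewrite inE hT; apply/eqP/mnmP => v.
by rewrite contentE -wF; apply: wt_ext.
Qed.

(** All that necessity uses of equal coefficients: which weights occur, without multiplicities. *)
Definition transfers n a b := forall F, ctab a F -> bounded n a F ->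
  exists G, [/\ ctab b G, bounded n b G & forall v, v < n -> wt b G v = wt a F (n.-1 - v)].

Lemma transfers_of_card n a b : is_composition a -> is_composition b ->
    (forall m : 'X_{1..n}, 0 < #|tableaux a m| -> 0 < #|tableaux b (rev_mnm m)|) ->
  transfers n a b.
Proof.
move=> ca cb h F ctF bF.
pose m : 'X_{1..n} := [multinom wt a F i | i < n].
have : 0 < #|tableaux a m|.
  by apply/tableaux_gt0 => //; exists F; split=> // v; rewrite mnmE.
move/h/tableaux_gt0 => /(_ cb)[G [ctG bG wG]]; exists G; split=> // v hv.
rewrite (wG (Ordinal hv)) !mnmE /=; congr wt; lia.
Qed.

(** The map between tableaux is a relation because the image is only known to exist; finite choice
    makes it a function. Extensionality of R is required since [tab] of the image agrees with [F']
    only inside the diagram. *)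
Lemma tableaux_leq n a (R : (nat -> nat -> nat) -> (nat -> nat -> nat) -> Prop) :
    is_composition a ->
    (forall F G H, (forall r c, c < nth 0 (rev a) r -> G r c = H r c) ->
      R F G -> R F H) ->
    (forall F, ctab a F -> bounded n a F -> exists F',
      [/\ ctab (rev a) F', bounded n (rev a) F', R F F' &
        forall v, v < n -> wt (rev a) F' v = wt a F (n.-1 - v)]) ->
    (forall F1 F2 F', ctab a F1 -> ctab a F2 -> bounded n a F1 -> bounded n a F2 ->
      R F1 F' -> R F2 F' -> forall r c, c < nth 0 a r -> F1 r c = F2 r c) ->
  forall m : 'X_{1..n}, #|tableaux a m| <= #|tableaux (rev a) (rev_mnm m)|.
Proof.
move=> ca Rext Rex Rinj m; set X := tableaux a m; set Y := tableaux _ _.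
have ex (i : 'I_#|X|) : exists T', T' \in Y /\ R (tab (enum_val i)) (tab T').
  have := enum_valP i; rewrite inE => /andP[hT /eqP eT].
  case: (Rex _ (ctab_tab ca hT) (@tab_bounded _ _ _)) => F' [ct' b' r' w'].
  case: (tableau_of_ctab ct' b') => T' hT' e; exists T'; split.
    rewrite inE hT'; apply/eqP/mnmP => v; rewrite contentE (wt_ext v e) w' //.
    rewrite -eT mnmE contentE /=; congr wt; lia.
  by apply: Rext r' => r c hc; rewrite e.
case: (@fin_all_exists 'I_#|X| (fun=> {ffun box (rev a) -> 'I_n})
  (fun i T' => T' \in Y /\ R (tab (enum_val i)) (tab T')) ex) => h hh.
have h_inj : injective h.
  move=> i j e; apply: enum_val_inj; apply: tab_inj.
  have := enum_valP i; rewrite inE => /andP[hi _].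
  have := enum_valP j; rewrite inE => /andP[hj _].
  case: (hh i) => _ ri; case: (hh j) => _; rewrite -e => rj.
  by apply: (Rinj _ _ _ _ _ _ _ ri rj); try exact: ctab_tab; exact: tab_bounded.
rewrite -[X in X <= _]card_ord -(card_codom h_inj); apply: subset_leq_card.
by apply/subsetP => y /codomP[i ->]; case: (hh i).
Qed.

(** * Weights that separate the two polynomials *)

Lemma ctab_constant_rows a f : (forall i j, i < j -> j < size a -> f i < f j) ->
  ctab a (fun r _ => f r).
Proof.
move=> f_incr; split=> // i j c ij.
- by move=> hj _; left; apply: f_incr (nth_gt0_size hj).
- move=> hi hij; right; apply: f_incr => //.
  by apply: (nth_gt0_size (c := c)); lia.
Qed.

Lemma wt_constant_rows a f (v : nat) :
  wt a (fun r _ => f r) v = \sum_(r < size a) nth 0 a r * (f r == v).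
Proof. by apply: eq_bigr => r _; rewrite sum_nat_const card_ord. Qed.

Section LowerLast.
Variables (a : seq nat) (f : nat -> nat) (p e : nat).
Hypotheses (hp : p.+1 < size a) (hq : 1 < nth 0 a p.+1).
(** Produces both separating weights: for a jump, f is the identity and e = p; for a step of one, f
    skips the letter e just below [f p]. *)
Definition lower_last r c := if (r == p.+1) && (c.+1 == nth 0 a r) then e else f r.

(** One letter [f p.+1] becomes e; the balance of sums avoids truncated subtraction. *)
Lemma wt_lower_last (v : nat) :
  wt a lower_last v + (f p.+1 == v) =
  \sum_(r < size a) nth 0 a r * (f r == v) + (e == v).
Proof.
rewrite /wt (bigD1 (Ordinal hp)) // [in RHS](bigD1 (Ordinal hp)) //=.
rewrite (_ : \sum_(r < size a | r != Ordinal hp) \sum_(c < nth 0 a r) (lower_last r c == v)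
  = \sum_(r < size a | r != Ordinal hp) nth 0 a r * (f r == v)); last first.
  apply: eq_bigr => r hr; rewrite -[in RHS](card_ord (nth 0 a r)) -sum_nat_const.
  apply: eq_bigr => c _; rewrite /lower_last.
  by rewrite (_ : (nat_of_ord r == p.+1) = false) //; apply: contraNF hr => /eqP h; apply/eqP/val_inj.
suff : \sum_(c < nth 0 a p.+1) (lower_last p.+1 c == v) + (f p.+1 == v)
  = nth 0 a p.+1 * (f p.+1 == v) + (e == v) by move=> h; rewrite addnAC h addnAC.
rewrite /lower_last eqxx /=; move: (hq); case: (nth 0 a p.+1) => // m _.
rewrite big_ord_recr /= eqxx (eq_bigr (fun=> (f p.+1 == v) : nat)); last first.
  by move=> c _; rewrite eqSS (ltn_eqF (ltn_ord c)).
rewrite sum_nat_const card_ord; lia.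
Qed.

Hypothesis f_incr : forall i j, i < j -> j < size a -> f i < f j.
Hypotheses (e_le : e <= f p) (e_gt : forall m, m < p -> f m < e).
(** The changed box either stands over a row p at least as long and is smaller than its entries, or
    row p is shorter by at least two and the box lies in no triple with it. *)
Hypothesis gap : nth 0 a p.+1 <= nth 0 a p /\ e < f p \/ (nth 0 a p).+1 < nth 0 a p.+1.

Let lower_last_le r c : r < size a -> lower_last r c <= f r.
Proof.
rewrite /lower_last; case: ifP => // /andP[/eqP -> _] _.
by apply: leq_trans e_le (ltnW (f_incr _ _)).
Qed.

Lemma ctab_lower_last : ctab a lower_last.
Proof.
split.
- move=> r c hr; rewrite {2}/lower_last (ltn_eqF hr) andbF.
  exact/lower_last_le/(nth_gt0_size hr).
- move=> i j ij hj; have hi := ltn_trans ij hj.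
  apply: leq_ltn_trans (lower_last_le 0 hi) _.
  rewrite /lower_last; case: ifP => [/andP[/eqP -> /eqP h]|_]; last exact: f_incr.
  by move: (hq); rewrite -h.
- move=> i j c ij hj hij; have hjl := nth_gt0_size hj; have hil := ltn_trans ij hjl.
  have hle := lower_last_le c hil.
  case: (boolP ((j == p.+1) && (c.+2 == nth 0 a j))) => hjc; last first.
    left; rewrite {2}/lower_last (negbTE hjc); apply: leq_ltn_trans hle _.
    exact: f_incr.
  rewrite [lower_last j _]/lower_last hjc; case/andP: hjc => /eqP ej _; subst j.
  move: ij; rewrite ltnS leq_eqVlt => /orP[/eqP ei|ip].
    right; subst i; rewrite /lower_last (ltn_eqF (ltnSn p)) /=.
    by case: gap => [[]//|]; lia.
  by left; apply: leq_ltn_trans hle (e_gt ip).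
- move=> i j c ij hi hij; have hj : c.+1 < nth 0 a j by apply: leq_trans hij.
  have hjl := nth_gt0_size hj; have hil := ltn_trans ij hjl.
  have hle := lower_last_le c hil; right.
  case: (boolP ((j == p.+1) && (c.+2 == nth 0 a j))) => hjc; last first.
    rewrite {2}/lower_last (negbTE hjc); apply: leq_ltn_trans hle _.
    exact: f_incr.
  rewrite [lower_last j _]/lower_last hjc; case/andP: hjc => /eqP ej /eqP hc; subst j.
  move: ij; rewrite ltnS leq_eqVlt => /orP[/eqP ei|ip].
    by subst i; case: gap; lia.
  exact: leq_ltn_trans hle (e_gt ip).
Qed.

Lemma bounded_lower_last n : (forall r, r < size a -> f r < n) -> bounded n a lower_last.
Proof.
by move=> h r c /nth_gt0_size hr; apply: leq_ltn_trans (lower_last_le c hr) (h _ hr).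
Qed.

End LowerLast.

Lemma wt_unbounded n a F v : bounded n a F -> n <= v -> wt a F v = 0.
Proof.
move=> bF hv; rewrite /wt big1 // => r _; rewrite big1 // => c _.
by have := bF r c (ltn_ord c); case: eqP => // ->; lia.
Qed.

Lemma sum_shift a s v :
  \sum_(r < size a) nth 0 a r * (s + r == v) = if s <= v then nth 0 a (v - s) else 0.
Proof.
case: (boolP (s <= v < s + size a)) => [/andP[h1 h2]|h].
  have hv : v - s < size a by lia.
  rewrite h1 (bigD1 (Ordinal hv)) //= subnKC // eqxx muln1 big1 ?addn0 // => r hr.
  rewrite (_ : (s + r == v) = false) ?muln0 //; apply: contraNF hr => /eqP e.
  by apply/eqP/val_inj; rewrite /=; lia.
rewrite big1 => [|r _]; first by case: ifP => // h1; rewrite nth_default //; lia.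
by have := ltn_ord r; case: eqP => e; rewrite ?muln0 //; move: h; rewrite -e; lia.
Qed.

Lemma sum_rev_parts a (g : nat -> nat -> nat) :
  \sum_(r < size a) g (nth 0 (rev a) r) r = \sum_(r < size a) g (nth 0 a r) (size a - r.+1).
Proof.
rewrite (reindex_inj rev_ord_inj) /=; apply: eq_bigr => r _.
by rewrite nth_rev; last (have := ltn_ord r; lia); congr (g (nth 0 a _)); have := ltn_ord r; lia.
Qed.

Lemma sum_wt_lt (a : seq nat) (f : nat -> nat) x :
  \sum_(v < x) \sum_(r < size a) nth 0 a r * (f r == v)
    = \sum_(r < size a) nth 0 a r * (f r < x).
Proof.
by rewrite exchange_big; apply: eq_bigr => r _; rewrite -big_distrr /= sum_eqn.
Qed.

Lemma sum_first_rows (a : seq nat) p : p <= size a ->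
  \sum_(r < size a) nth 0 a r * (r < p) = \sum_(r < p) nth 0 a r.
Proof.
move=> hp; rewrite (big_ord_widen _ (fun r => nth 0 a r) hp) [RHS]big_mkcond.
by apply: eq_bigr => r _; case: ifP => _; rewrite ?muln1 ?muln0.
Qed.

(* In a tableau with as many letters as rows, the entries of the rows up to p
   are among the first p + 1 letters; the weight below has one too few of
   those. *)
Lemma no_raised_weight a G s p : is_composition a -> ctab a G -> p.+1 < size a ->
    (forall v, wt a G v + (s + p == v) =
      \sum_(r < size a) nth 0 a r * (s + r == v) + (s + p.+1 == v)) ->
  False.
Proof.
move=> ca ctG hp hw.
have supp r c : c < nth 0 a r -> G r c < s + size a.
  move=> hc; have := wt_gt0 G hc; have := hw (G r c).
  case: (ltnP (G r c) (s + size a)) => // h; rewrite sum_shift; case: ifP => _.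
    by rewrite nth_default; lia.
  by lia.
have hG r : r < size a -> G r 0 <= s + r.
  move=> hr; have h : r + ((size a).-1 - r) < size a by lia.
  have := ctab_col0_step ctG h; have := supp _ 0 (composition_gt0 ca h); lia.
have rows r c : r < p.+1 -> c < nth 0 a r -> G r c < s + p.+1.
  move=> hr hc; have hps : p < size a by lia.
  by apply: leq_ltn_trans (ctab_entry_le ctG (r' := p) _ hps hc) _; have := hG p hps; lia.
have := sum_rows_le_wt (ltnW hp) rows.
have : \sum_(v < s + p.+1) (wt a G v + (s + p == v)) =
    \sum_(v < s + p.+1) (\sum_(r < size a) nth 0 a r * (s + r == v) + (s + p.+1 == v)).
  by apply: eq_bigr => v _; apply: hw.
rewrite !big_split /= (sum_wt_lt a (addn s)) !sum_eqn.
under [X in _ = X + _ -> _]eq_bigr do rewrite ltn_add2l.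
rewrite sum_first_rows ?(ltnW hp) // ltnn addn0 => <-.
by rewrite ltn_add2l ltnSn; set W := \sum_(v < _) _; lia.
Qed.

(** The letter [i.+2] occurs once in this weight. If row i began with a letter at most i, the rows
    up to i would need one more such letter than there are. So it begins above i, which forces
    [i.+2] into column 0 of row [i.+1] and, that row being longer than row i, into column 1 as
    well. *)
Lemma no_inserted_weight a G i : is_composition a -> ctab a G -> i.+1 < size a ->
    nth 0 a i < nth 0 a i.+1 ->
    (forall v, wt a G v + (i == v) =
      \sum_(r < size a) nth 0 a r * (r + (i.+1 < r) == v) + (i.+2 == v)) ->
  False.
Proof.
move=> ca ctG hi hlt hw.
have i0 := composition_gt0 ca (ltnW hi).
have supp r c : c < nth 0 a r -> G r c <= size a.
  move=> hc; have := wt_gt0 G hc; have := hw (G r c).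
  case: (leqP (G r c) (size a)) => // h; rewrite big1; last first.
    by move=> x _; have := ltn_ord x; case: eqP; lia.
  by lia.
have hG r : r < size a -> G r 0 <= r.+1.
  move=> hr; have h : r + ((size a).-1 - r) < size a by lia.
  have := ctab_col0_step ctG h; have := supp _ 0 (composition_gt0 ca h); lia.
have Gi : i < G i 0.
  rewrite ltnNge; apply/negP => Gi.
  have rows r c : r < i.+1 -> c < nth 0 a r -> G r c < i.+1.
    move=> hr hc; have hil : i < size a by lia.
    by apply: leq_ltn_trans (ctab_entry_le ctG (r' := i) _ hil hc) _; lia.
  have := sum_rows_le_wt (ltnW hi) rows.
  have : \sum_(v < i.+1) (wt a G v + (i == v)) =
      \sum_(v < i.+1) (\sum_(r < size a) nth 0 a r * (r + (i.+1 < r) == v) + (i.+2 == v)).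
    by apply: eq_bigr => v _; apply: hw.
  rewrite !big_split /= (sum_wt_lt a (fun r => r + (i.+1 < r))).
  rewrite !sum_eqn.
  have -> : \sum_(r < size a) nth 0 a r * (r + (i.+1 < r) < i.+1)
      = \sum_(r < size a) nth 0 a r * (r < i.+1).
    by apply: eq_bigr => r _; congr (_ * nat_of_bool _); lia.
  rewrite sum_first_rows ?(ltnW hi) // (ltnNge i.+2) leqnSn addn0 => <-.
  by rewrite ltnSn; set W := \sum_(v < _) _; lia.
have G1 : G i.+1 0 = i.+2.
  by have := hG _ hi; have := ctab_col0 ctG (ltnSn i) hi; lia.
have G11 : G i.+1 1 = i.+2.
  have := ctab_longer ctG (ltnSn i) i0 hlt.
  have h1 : 1 < nth 0 a i.+1 by lia.
  by have := ctab_row ctG h1; lia.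
have := hw i.+2; rewrite eqxx big1; last first.
  by move=> x _; case: eqP => //; lia.
rewrite /wt (bigD1 (Ordinal hi)) //=.
have h0 : 0 < nth 0 a i.+1 by lia.
have h1 : 1 < nth 0 a i.+1 by lia.
rewrite (bigD1 (Ordinal h0)) //= (bigD1 (Ordinal h1)) //= G1 G11 eqxx; lia.
Qed.

Lemma transfers_no_jump n a i : is_composition a -> size a <= n ->
  transfers n a (rev a) -> i.+1 < size a -> (nth 0 a i).+1 < nth 0 a i.+1 -> False.
Proof.
move=> ca an tr hi hgap.
have idm (j k : nat) : j < k -> k < size a -> id j < id k by [].
have hq : 1 < nth 0 a i.+1 by lia.
have cF := ctab_lower_last (f := id) hi hq idm (leqnn i) (fun m h => h) (or_intror hgap).
have bF : bounded n a (lower_last a id i i).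
  apply: bounded_lower_last => //; move=> r hr; rewrite /=; lia.
case: (tr _ cF bF) => G [ctG bG wG].
have cra : is_composition (rev a) by rewrite /is_composition all_rev.
(* Under reversal and complementation, lowering [i.+1] to i becomes raising the letter of row
   [size a - i.+2], and the letters used become the last [size a] ones. *)
have hp : (size a - i.+2).+1 < size (rev a) by rewrite size_rev; lia.
apply: (no_raised_weight (s := n - size a) cra ctG hp) => v.
rewrite size_rev (sum_rev_parts a (fun x r => x * (n - size a + r == v))).
case: (ltnP v n) => hv; last first.
  rewrite (wt_unbounded bG hv) big1; last by move=> r _; have := ltn_ord r; case: eqP; lia.
  by lia.
rewrite wG //.
have := wt_lower_last id i hi hq (n.-1 - v).
rewrite [X in _ = X + _ -> _](eq_bigr
  (fun r : 'I_(size a) => nth 0 a r * (n - size a + (size a - r.+1) == v))).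
  move: (wt _ _ _) (\sum_(r < _) _) => w S; rewrite /=; lia.
by move=> r _; congr (_ * nat_of_bool _); have := ltn_ord r; rewrite /=; lia.
Qed.

Lemma transfers_no_step n a i : is_composition a -> size a < n ->
  transfers n (rev a) a -> i.+1 < size a -> 1 < nth 0 a i ->
  nth 0 a i.+1 = (nth 0 a i).+1 -> False.
Proof.
move=> ca an tr hi h2 hstep.
(* Rows p and [p.+1] of [rev a] are rows [i.+1] and i of a. The last [size a + 1] letters are used;
   [s + p] is kept for the changed box, and its complement is [i.+2]. *)
pose p := size a - i.+2; pose s := n - (size a).+1.
pose f r := s + r + (p <= r).
have cra : is_composition (rev a) by rewrite /is_composition all_rev.
have idm (j k : nat) : j < k -> k < size (rev a) -> f j < f k by rewrite /f; lia.
have hp : p.+1 < size (rev a) by rewrite size_rev /p; lia.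
have ep : nth 0 (rev a) p = nth 0 a i.+1.
  by rewrite nth_rev; [congr nth; rewrite /p|rewrite /p]; lia.
have eq : nth 0 (rev a) p.+1 = nth 0 a i.
  by rewrite nth_rev; [congr nth; rewrite /p|rewrite /p]; lia.
have hq : 1 < nth 0 (rev a) p.+1 by rewrite eq.
have e_le : s + p <= f p by rewrite /f; lia.
have e_gt m : m < p -> f m < s + p by rewrite /f; lia.
have gap : nth 0 (rev a) p.+1 <= nth 0 (rev a) p /\ s + p < f p \/
    (nth 0 (rev a) p).+1 < nth 0 (rev a) p.+1.
  by left; rewrite ep eq /f hstep; split; lia.
have cF := ctab_lower_last hp hq idm e_le e_gt gap.
have bF : bounded n (rev a) (lower_last (rev a) f p (s + p)).
  by apply: (bounded_lower_last hp idm e_le) => r; rewrite size_rev /f /s; lia.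
case: (tr _ cF bF) => G [ctG bG wG].
apply: (no_inserted_weight ca ctG hi); first by rewrite hstep.
move=> v; case: (ltnP v n) => hv; last first.
  rewrite (wt_unbounded bG hv) big1; last by move=> r _; have := ltn_ord r; case: eqP; lia.
  by lia.
rewrite wG //.
have := wt_lower_last f (s + p) hp hq (n.-1 - v).
rewrite size_rev (sum_rev_parts a (fun x r => x * (f r == n.-1 - v))).
rewrite [X in _ = X + _ -> _](eq_bigr
  (fun r : 'I_(size a) => nth 0 a r * (r + (i.+1 < r) == v))).
  move: (wt _ _ _) (\sum_(r < _) _) => w S; rewrite /f /s /p; lia.
by move=> r _; congr (_ * nat_of_bool _); have := ltn_ord r; rewrite /f /s /p; lia.
Qed.

(** * Dominance of weights and equality of the two compositions *)

Section Dominance.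
Variables (n : nat) (b : seq nat) (F : nat -> nat -> nat).
Hypotheses (ctF : ctab b F) (bF : bounded n b F).

Let cnt c v := \sum_(r < size b | c < nth 0 b r) (F r c == v).

Let cnt_le1 c v : cnt c v <= 1.
Proof. exact: column_count_le1. Qed.

Lemma sum_cnt_le C v : \sum_(c < C) cnt c v <= minn (wt b F v) C.
Proof.
rewrite leq_min; apply/andP; split; last first.
  rewrite -[X in _ <= X]card_ord -sum1_card; exact: leq_sum.
case: (part_bound b) => K hK.
have hK' r : nth 0 b r <= K + C by apply: leq_trans (hK r) (leq_addr _ _).
rewrite (wt_columns _ _ hK') (big_ord_widen _ (cnt^~ v) (leq_addl K C)).
by rewrite [X in _ <= X](bigID (fun c : 'I_(K + C) => c < C)) leq_addr.
Qed.

Lemma sum_cnt C : \sum_(v < n) \sum_(c < C) cnt c v = \sum_(r < size b) minn (nth 0 b r) C.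
Proof.
rewrite exchange_big /=.
transitivity (\sum_(c < C) \sum_(r < size b | c < nth 0 b r) 1).
  apply: eq_bigr => c _; rewrite exchange_big /=; apply: eq_bigr => r hr.
  by rewrite sum_eqn bF.
rewrite (exchange_big_dep xpredT) //=; apply: eq_bigr => r _.
elim: C => [|C IH]; first by rewrite big_ord0 minn0.
by rewrite big_mkcond big_ord_recr /= -big_mkcond /= IH; case: ifP; lia.
Qed.

(** The left side counts the boxes of the first C columns, where each letter occurs at most once per
    column. *)
Lemma min_weight_le C :
  \sum_(r < size b) minn (nth 0 b r) C <= \sum_(v < n) minn (wt b F v) C.
Proof. by rewrite -sum_cnt; apply: leq_sum => v _; apply: sum_cnt_le. Qed.

Hypothesis tight : forall C,
  \sum_(v < n) minn (wt b F v) C <= \sum_(r < size b) minn (nth 0 b r) C.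

Let cnt_tight C v : v < n -> \sum_(c < C) cnt c v = minn (wt b F v) C.
Proof.
move=> hv.
have h (u : 'I_n) : true -> \sum_(c < C) cnt c u <= minn (wt b F u) C
    ?= iff (\sum_(c < C) cnt c u == minn (wt b F u) C).
  by move=> _; exact/leqif_eq/sum_cnt_le.
case: (leqif_sum h) => _; rewrite eqn_leq sum_cnt tight -sum_cnt.
rewrite leq_sum => [|u _]; last exact: sum_cnt_le.
by move=> /esym/forallP/(_ (Ordinal hv))/eqP.
Qed.

Lemma cnt_gt0 c v : 0 < cnt c v -> exists2 r, c < nth 0 b r & F r c = v.
Proof.
move=> h; case: (pickP (fun r : 'I_(size b) => (c < nth 0 b r) && (F r c == v))).
  by move=> r /andP[h1 /eqP h2]; exists r.
move=> h0; move: h; rewrite /cnt big1 // => r hr.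
by have := h0 r; rewrite hr /= => ->.
Qed.

Lemma cnt_entry r c : c < nth 0 b r -> 0 < cnt c (F r c).
Proof.
by move=> hc; rewrite /cnt (bigD1 (Ordinal (nth_gt0_size hc))) //= eqxx; lia.
Qed.

(** By tightness the first C columns contain a letter of weight w exactly min(w, C) times, so it
    occupies its columns without gaps. *)
Lemma tight_prev_column r c : c.+1 < nth 0 b r ->
  exists2 r', c < nth 0 b r' & F r' c = F r c.+1.
Proof.
move=> hc; apply: cnt_gt0; have hv := bF hc; have := cnt_entry hc.
have := cnt_le1 c.+1 (F r c.+1); have := cnt_le1 c (F r c.+1).
have := cnt_tight c.+2 hv; have := cnt_tight c.+1 hv; have := cnt_tight c hv.
rewrite !big_ord_recr /=; lia.
Qed.

(** The letter of box (r, c.+1) also occurs in column c, in some row i. If i is below r, the triple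
    conditions fail; if i is above r, row i begins with that letter and the first column does not
    increase. *)
Lemma tight_constant_rows r c : c < nth 0 b r -> F r c = F r 0.
Proof.
elim: c r => // c IH r hr.
case: (tight_prev_column hr) => i hi e.
have le := ctab_row ctF hr.
have ri : F r 0 = F r c by rewrite IH //; lia.
have ii := IH i hi.
case: (ltngtP i r) => ir; last by rewrite -e ir -ri.
- case: (ltnP (nth 0 b i) (nth 0 b r)) => len.
    by have := ctab_longer ctF ir hi len; lia.
  have hi' : c.+1 < nth 0 b i by apply: leq_trans len.
  case: (ctab_next ctF ir hi' hr); first by lia.
  by have := ctab_row ctF hi'; lia.
- by have := ctab_col0 ctF ir (nth_gt0_size hi); lia.
Qed.

End Dominance.

Lemma sum_nth_widen (a : seq nat) n (g : nat -> nat) : size a <= n -> g 0 = 0 ->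
  \sum_(r < size a) g (nth 0 a r) = \sum_(r < n) g (nth 0 a r).
Proof.
move=> an g0; rewrite (big_ord_widen _ (fun r => g (nth 0 a r)) an) big_mkcond.
by apply: eq_bigr => r _; case: ltnP => // h; rewrite nth_default.
Qed.

Lemma composition_eq n a b F : is_composition a -> is_composition b ->
    size a <= n -> ctab b F -> bounded n b F ->
    (forall v, v < n -> wt b F v = nth 0 a v) ->
    (forall C, \sum_(r < size a) minn (nth 0 a r) C <= \sum_(r < size b) minn (nth 0 b r) C) ->
  a = b.
Proof.
move=> ca cb an ctF bF wF hC.
have eC C : \sum_(v < n) minn (wt b F v) C = \sum_(r < size a) minn (nth 0 a r) C.
  rewrite (sum_nth_widen (g := minn^~ C) an) ?min0n //.
  by apply: eq_bigr => v _; rewrite wF.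
have tight C : \sum_(v < n) minn (wt b F v) C <= \sum_(r < size b) minn (nth 0 b r) C.
  by rewrite eC.
(* For C = 1 the truncated sums count the parts, which gives equal lengths. *)
have szE x : is_composition x -> \sum_(r < size x) minn (nth 0 x r) 1 = size x.
  move=> cx; rewrite -[RHS]card_ord -sum1_card; apply: eq_bigr => r _.
  by have := composition_gt0 cx (ltn_ord r); lia.
have sz : size a = size b.
  apply/eqP; rewrite eqn_leq -{1}(szE a ca) -{1}(szE b cb) hC /=.
  by rewrite -[X in X <= _](szE b cb) -[X in _ <= X](szE a ca) -eC min_weight_le.
have F0 r : r < size b -> F r 0 = r.
  apply: (increasing_eq (f := F^~ 0) (g := id)) => //; first exact: ctab_col0 ctF.
  move=> i hi; exists (F i 0) => //.
  have h := composition_gt0 cb hi.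
  have := wt_gt0 F h; rewrite wF; last exact: bF.
  by move/nth_gt0_size; rewrite sz.
apply: (@eq_from_nth _ 0) => // i hi; rewrite -wF; last by lia.
rewrite (wt_ext (G := fun r _ => 0 + r)) => [|r c hc]; last first.
  by rewrite (tight_constant_rows ctF bF tight hc) F0 // (nth_gt0_size hc).
by rewrite (wt_constant_rows b (fun r => 0 + r)) sum_shift subn0.
Qed.

(** The row-constant tableau of [rev a] on the last letters transfers to a tableau of shape b and
    weight a; the row-constant tableau of b supplies the opposite dominance. *)
Lemma transfers_eq n a b : is_composition a -> is_composition b ->
  size a <= n -> size b <= n -> transfers n (rev a) b -> transfers n b (rev a) -> a = b.
Proof.
move=> ca cb an bn t1 t2.
have [||F [ctF bF wF]] := t1 (fun r _ => n - size a + r).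
- by apply: ctab_constant_rows; lia.
- by move=> r c /nth_gt0_size; rewrite size_rev; lia.
apply: (composition_eq ca cb an ctF bF) => [v hv|C].
  rewrite wF // (wt_constant_rows _ (fun r => n - size a + r)) sum_shift.
  case: (ltnP v (size a)) => h; last by rewrite [RHS]nth_default //; case: ifP; lia.
  have -> : n - size a <= n.-1 - v by lia.
  by rewrite nth_rev; [congr nth; lia|lia].
have [||G [ctG bG wG]] := t2 (fun r _ => 0 + r).
- by apply: ctab_constant_rows; lia.
- by move=> r c /nth_gt0_size; lia.
have cra : is_composition (rev a) by rewrite /is_composition all_rev.
have := min_weight_le ctG bG C.
rewrite size_rev (sum_rev_parts a (fun x _ => minn x C)) => h; apply: leq_trans h _.
rewrite (sum_nth_widen (g := minn^~ C) bn) ?min0n // (reindex_inj rev_ord_inj) /=.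
apply: leq_sum => v _; rewrite wG; last by have := ltn_ord v; lia.
rewrite (wt_constant_rows _ (fun r => 0 + r)) sum_shift /= subn0.
by rewrite (_ : n.-1 - (n - v.+1) = v) //; have := ltn_ord v; lia.
Qed.

(** * Symmetry of the tableau counts under the stated conditions *)

Definition near_parts (p q : nat) := (p <= q.+1) && (q <= p.+1).

Lemma crossing (g : nat -> nat) m i c : m < i -> g m <= c -> c.+1 < g i ->
  (forall j, j < i -> g j.+1 <= (g j).+1) -> exists2 r, m < r < i & g r = c.+1.
Proof.
elim: i => // i IH hmi hm hi st; have := st i (ltnSn i).
case: (eqVneq (g i) c.+1) => [e|ne] hs.
  exists i => //; rewrite ltnSn andbT ltn_neqAle -ltnS hmi andbT.
  by apply/eqP => e'; move: hm; rewrite e' e ltnn.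
have mi : m < i.
  rewrite ltn_neqAle -ltnS hmi andbT; apply/eqP => e'; rewrite e' in hm; lia.
case: IH => //; [by lia|by move=> j hj; apply: st; lia|].
by move=> r hr er; exists r => //; lia.
Qed.

(** With as many letters as rows, row i begins with i. A smaller entry m in row i would conflict
    with row m, constant by induction, or with a row between them. *)
Lemma near_parts_constant_rows a F : is_composition a -> ctab a F ->
    bounded (size a) a F -> sorted near_parts a ->
  forall r c, c < nth 0 a r -> F r c = r.
Proof.
move=> ca ctF bF /(sortedP 0) near r.
elim/ltn_ind: r => i IH c; case: c => [|c] hc.
  have hi := nth_gt0_size hc.
  have h : i + ((size a).-1 - i) < size a by lia.
  have := ctab_col0_step ctF h; have := ctab_col0_ge ctF hi.
  by have := bF _ 0 (composition_gt0 ca h); lia.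
have hi := nth_gt0_size hc.
have Fi0 : F i 0 <= i.
  have h : i + ((size a).-1 - i) < size a by lia.
  have := ctab_col0_step ctF h.
  by have := bF _ 0 (composition_gt0 ca h); lia.
have le := ctab_row_le ctF (leq0n c.+1) hc.
have := leq_trans le Fi0; rewrite leq_eqVlt => /orP[/eqP //|lt].
exfalso; set m := F i c.+1 in lt.
case: (ltnP c (nth 0 a m)) => hm.
  have Fm := IH m lt c hm.
  case: (ltnP c.+1 (nth 0 a m)) => hm'.
    by case: (ctab_next ctF lt hm' hc); rewrite ?Fm -/m ?(IH m lt c.+1 hm') ltnn.
  have := ctab_longer ctF lt hm; rewrite Fm -/m ltnn; lia.
(* Row m ends before column c, so some row r between m and i has length [c.+1]; then [ctab_longer]
   gives r < m. *)
case: (crossing (g := nth 0 a) lt hm hc) => [j hj|r /andP[mr ri] er].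
  by have /andP[] := near j (leq_ltn_trans hj hi).
have hr : c < nth 0 a r by rewrite er.
by have := ctab_longer ctF ri hr; rewrite (IH r ri c hr) -/m; lia.
Qed.

Lemma rotation_symmetry n k a : is_composition a ->
    (forall r, r < size a -> nth 0 a r = k \/ nth 0 a r = 1 /\ k = 2) ->
  forall m : 'X_{1..n}, #|tableaux a m| <= #|tableaux (rev a) (rev_mnm m)|.
Proof.
move=> ca parts; apply: (@tableaux_leq n a (rotated n a)) => //.
- move=> F G H GH rot c; case: (rot c) => p hp; exists p => r.
  by case: (hp r) => e h; split=> // hc; rewrite -GH // h.
- move=> F ctF bF; case: (rotation_exists ca ctF bF parts) => F' [ct' b' rot].
  by exists F'; split=> // v; apply: rotated_wt.
- by move=> F1 F2 F' ct1 ct2 b1 b2; apply: rotated_inj.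
Qed.

(** The relation can be trivial because there is at most one tableau of shape a. *)
Lemma near_parts_symmetry n a : is_composition a -> n = size a -> sorted near_parts a ->
  forall m : 'X_{1..n}, #|tableaux a m| <= #|tableaux (rev a) (rev_mnm m)|.
Proof.
move=> ca -> near; apply: (@tableaux_leq _ a (fun _ _ => True)) => //.
- move=> F ctF bF; exists (fun r _ => 0 + r); split=> //.
  + by apply: ctab_constant_rows; lia.
  + by move=> r c /nth_gt0_size; rewrite size_rev.
  move=> v hv; rewrite (wt_ext (G := fun r _ => 0 + r)) => [|r c hc]; last first.
    by rewrite (near_parts_constant_rows ca ctF bF near hc).
  rewrite !(wt_constant_rows _ (fun r => 0 + r)) !sum_shift /= !subn0.
  by rewrite nth_rev //; congr nth; lia.
- move=> F1 F2 _ ct1 ct2 b1 b2 _ _ r c hc.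
  by rewrite !(near_parts_constant_rows ca _ _ near hc).
Qed.

Lemma sorted_near_parts_rev a : sorted near_parts (rev a) = sorted near_parts a.
Proof. by rewrite rev_sorted; apply: eq_sorted => p q; rewrite /near_parts andbC. Qed.

(** * From conditions on adjacent parts to the theorem *)

Lemma not_all_12 a : is_composition a ->
  all (fun p => (p == 1) || (p == 2)) a = false ->
  exists2 i, i < size a & 2 < nth 0 a i.
Proof.
move=> ca /negbT /allPn[x xa hx]; exists (index x a); first by rewrite index_mem.
by rewrite nth_index //; move/allP: ca => /(_ x xa); lia.
Qed.

(** A part above 2 excludes the second alternative at its neighbours, so its value spreads in both
    directions. *)
Lemma constant_of_steps (a : seq nat) j : j < size a -> 2 < nth 0 a j ->
    (forall i, i.+1 < size a -> nth 0 a i = nth 0 a i.+1 \/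
      nth 0 a i <= 2 /\ nth 0 a i.+1 <= 2) ->
  constant a.
Proof.
move=> hj j2 step; apply: (all_pred1_constant (x := nth 0 a j)).
apply/(all_nthP 0) => i hi; apply/eqP.
have up d : j + d < size a -> nth 0 a (j + d) = nth 0 a j.
  elim: d => [|d IH]; rewrite ?addn0 // addnS => h.
  by case: (step _ h); rewrite IH //; lia.
have down d : d <= j -> nth 0 a (j - d) = nth 0 a j.
  elim: d => [|d IH] h; rewrite ?subn0 //.
  have e : (j - d.+1).+1 = j - d by lia.
  have := step (j - d.+1); rewrite e IH; last by lia.
  by case; lia.
case: (leqP j i) => h; first by rewrite -(subnKC h) up // subnKC.
by rewrite -(subKn (ltnW h)) down // leq_subr.
Qed.

Theorem mainTheorem9 (n : nat) (alpha beta : seq nat)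
    (comp_alpha : is_composition alpha) (comp_beta : is_composition beta)
    (size_alpha : size alpha <= n) (size_beta : size beta <= n) :
  young_quasisymmetric_schur n alpha = quasisymmetric_schur n beta <->
  alpha = beta /\
  [\/ constant alpha,
      all (fun p => (p == 1) || (p == 2)) alpha
    | n = size alpha /\
      sorted (fun p q => (p <= q.+1) && (q <= p.+1)) alpha].
Proof.
have cra : is_composition (rev alpha) by rewrite /is_composition all_rev.
split=> [/young_eq_quasisymmetric_schur cards|].
  have t1 : transfers n (rev alpha) beta.
    by apply: transfers_of_card => // m; rewrite -cards rev_mnmK.
  have t2 : transfers n beta (rev alpha).
    by apply: transfers_of_card => // m; rewrite -cards.
  have ab := transfers_eq comp_alpha comp_beta size_alpha size_beta t1 t2.
  split=> //; subst beta.
  (* Falling steps of alpha are rising steps of [rev alpha], to which the same lemmas are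
     applied. *)
  have t3 : transfers n (rev alpha) (rev (rev alpha)) by rewrite revK.
  have t4 : transfers n (rev (rev alpha)) (rev alpha) by rewrite revK.
  have size_ralpha : size (rev alpha) <= n by rewrite size_rev.
  have rev_nth i : i.+1 < size alpha -> [/\ (size alpha - i.+2).+1 < size (rev alpha),
      nth 0 (rev alpha) (size alpha - i.+2) = nth 0 alpha i.+1 &
      nth 0 (rev alpha) (size alpha - i.+2).+1 = nth 0 alpha i].
    by move=> hi; rewrite !nth_rev ?size_rev; try lia; split; try congr nth; lia.
  have near : sorted near_parts alpha.
    apply/(sortedP 0) => i hi; case: (rev_nth i hi) => hr e1 e2.
    apply/andP; split; rewrite leqNgt; apply/negP => h.
      by apply: (transfers_no_jump cra size_ralpha t3 hr); rewrite e1 e2.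
    exact: (transfers_no_jump comp_alpha size_alpha t2 hi h).
  case: (boolP (all _ alpha)) => [h|/negbTE h12]; first by apply: Or32.
  case: (ltngtP n (size alpha)) => sz; [lia| |by apply: Or33].
  apply: Or31; case: (not_all_12 comp_alpha h12) => j hj j2.
  apply: (constant_of_steps hj j2) => i hi; case: (rev_nth i hi) => hr e1 e2.
  move/(sortedP 0): near => /(_ i hi) /andP[n1 n2].
  (* With a spare letter, a step of one is possible only between parts 1 and 2. *)
  have up : 1 < nth 0 alpha i -> nth 0 alpha i.+1 <> (nth 0 alpha i).+1.
    move=> h e; exact: (transfers_no_step comp_alpha sz t1 hi h e).
  have dn : 1 < nth 0 alpha i.+1 -> nth 0 alpha i <> (nth 0 alpha i.+1).+1.
    move=> h e; apply: (transfers_no_step cra _ t4 hr); rewrite ?e1 ?e2 //.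
    by rewrite size_rev.
  case: (leqP (nth 0 alpha i) 1) => a1; case: (leqP (nth 0 alpha i.+1) 1) => a2;
    try (have := up a1); try (have := dn a2); lia.
move=> [<- {beta comp_beta size_beta} h]; apply/young_eq_quasisymmetric_schur => m.
apply/eqP; rewrite eqn_leq; apply/andP.
(* Injections in both directions, for alpha and for its reversal, give equal counts. *)
suff H a : a = alpha \/ a = rev alpha ->
    forall m : 'X_{1..n}, #|tableaux a m| <= #|tableaux (rev a) (rev_mnm m)|.
  split; last exact: H (or_introl erefl) m.
  by have := H _ (or_intror erefl) (rev_mnm m); rewrite revK rev_mnmK.
move=> ha {m}.
have ca : is_composition a by case: ha => ->.
have parts k : all (fun p => (p == k) || (p == 1) && (k == 2)) alpha ->
    forall r, r < size a -> nth 0 a r = k \/ nth 0 a r = 1 /\ k = 2.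
  move=> hk r hr; have : nth 0 a r \in alpha.
    by case: ha hr => -> hr; [exact: mem_nth|rewrite -mem_rev; exact: mem_nth].
  by move/(allP hk) => /orP[/eqP ->|/andP[/eqP -> /eqP ->]]; auto.
case: h => [/(constantP 0)[k e]|h12|[e near]].
- apply: (rotation_symmetry ca (parts k _)).
  by rewrite e; apply/allP => p /nseqP[-> _]; rewrite eqxx.
- apply: (rotation_symmetry ca (parts 2 _)).
  by apply: sub_all h12 => p; rewrite andbT orbC.
- apply: near_parts_symmetry => //; first by case: ha => ->; rewrite ?size_rev.
  by case: ha => ->; rewrite ?sorted_near_parts_rev.
Qed.
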